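(* Let $S$ be a set with two binary operations $+$ and $\cdot$. Then: (i) $(S,+,\cdot)$ is a symmetric weak left brace if and only if it is a strong semilattice of a family of symmetric skew left braces; (ii) $(S,+,\cdot)$ is a $\lambda$-homomorphic weak left brace if and only if it is a strong semilattice of a family of $\lambda$-homomorphic skew left braces; (iii) $(S,+,\cdot)$ is a $\lambda$-anti-homomorphic weak left brace if and only if it is a strong semilattice of a family of $\lambda$-anti-homomorphic skew left braces.
   Context: A semigroup $(S,+)$ (not necessarily commutative) is an inverse semigroup if for each $a\in S$ there is a unique element $-a$ with $a-a+a=a$ and $-a+a-a=-a$; for an inverse semigroup $(S,\cdot)$ written multiplicatively this element is written $a^{-1}$. Juxtaposition denotes $\cdot$. A weak left brace is a triple $(S,+,\cdot)$ with $(S,+)$ and $(S,\cdot)$ inverse semigroups such that $x(y+z)=xy-x+xz$ and $xx^{-1}=-x+x$ for all $x,y,z\in S$. A skew left brace is a weak left brace in which $(S,+)$ and $(S,\cdot)$ are both groups. A skew left brace homomorphism is a map preserving both operations. In a weak left brace let $\lambda_x(y)=-x+xy$; each $\lambda_x$ is an endomorphism of $(S,+)$. A weak left brace is $\lambda$-homomorphic if $\lambda_x\lambda_y=\lambda_{x+y}$ for all $x,y\in S$, and $\lambda$-anti-homomorphic if $\lambda_y\lambda_x=\lambda_{x+y}$ for all $x,y\in S$ (products are compositions of maps, $\lambda_x\lambda_y(z)=\lambda_x(\lambda_y(z))$). A $\lambda$-homomorphic (respectively $\lambda$-anti-homomorphic) skew left brace is a skew left brace with this property. A symmetric weak left brace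 is a triple $(S,+,\cdot)$ with $(S,+)$ and $(S,\cdot)$ inverse semigroups such that $x(y+z)=xy-x+xz$ and $x+(yz)=(x+y)x^{-1}(x+z)$ for all $x,y,z\in S$. It is a symmetric skew left brace if both $(S,+)$ and $(S,\cdot)$ are groups. Strong semilattice: let $Y$ be a lower semilattice (a partially ordered set in which any two elements $\alpha,\beta$ have a greatest lower bound $\alpha\beta$), let $\{(B_\alpha,+,\cdot)\mid\alpha\in Y\}$ be a family of pairwise disjoint skew left braces, and for each pair $\alpha\ge\beta$ in $Y$ let $\phi_{\alpha,\beta}:B_\alpha\to B_\beta$ be a skew left brace homomorphism such that $\phi_{\alpha,\alpha}=\mathrm{id}_{B_\alpha}$ for all $\alpha$ and $\phi_{\beta,\gamma}\phi_{\alpha,\beta}=\phi_{\alpha,\gamma}$ whenever $\alpha\ge\beta\ge\gamma$. The strong semilattice $S=[Y;B_\alpha;\phi_{\alpha,\beta}]$ of the skew left braces $B_\alpha$ is $S=\bigcup_{\alpha\in Y}B_\alpha$ with operations $a+b=\phi_{\alpha,\alpha\beta}(a)+\phi_{\beta,\alpha\beta}(b)$ and $ab=\phi_{\alpha,\alpha\beta}(a)\,\phi_{\beta,\alpha\beta}(b)$ for $a\in B_\alpha$, $b\in B_\beta$. *)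

(* Defs.v *)
From mathcomp Require Import all_boot all_order.
From Stdlib Require Import ClassicalEpsilon.
Set Implicit Arguments.
Unset Strict Implicit.
Unset Printing Implicit Defensive.
Import Order.TTheory.
Local Open Scope order_scope.

Definition binop (T : Type) := T -> T -> T.

Section OneOperation.
Variables (T : Type) (op : binop T).

Definition is_inverse_of (a b : T) : Prop :=
  op (op a b) a = a /\ op (op b a) b = b.

Definition inverse_semigroup : Prop :=
  associative op /\ forall a, exists! b, is_inverse_of a b.

(* The inverse of [a]; meaningful only when [op] is an inverse semigroup. *)
Definition sinv (a : T) : T := epsilon (inhabits a) (is_inverse_of a).

Definition is_group : Prop :=
  associative op /\
  exists e, [/\ left_id e op, right_id e op &
                forall x, exists y, op y x = e /\ op x y = e].

End OneOperation.

Section TwoOperations.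
Variables (T : Type) (add mul : binop T).

Local Notation "x + y" := (add x y).
Local Notation "- x" := (sinv add x).
Local Notation "x - y" := (add x (sinv add y)).
Local Notation "x * y" := (mul x y).
Local Notation "x ^-1" := (sinv mul x).

Definition weak_left_brace : Prop :=
  [/\ inverse_semigroup add, inverse_semigroup mul,
      forall x y z, x * (y + z) = x * y - x + x * z &
      forall x, x * x^-1 = - x + x].

Definition skew_left_brace : Prop :=
  [/\ weak_left_brace, is_group add & is_group mul].

Definition lambda (x y : T) : T := - x + x * y.

Definition lambda_homomorphic : Prop :=
  forall x y, lambda x \o lambda y =1 lambda (x + y).

Definition lambda_anti_homomorphic : Prop :=
  forall x y, lambda y \o lambda x =1 lambda (x + y).

Definition lambda_hom_weak_left_brace : Prop :=
  weak_left_brace /\ lambda_homomorphic.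

Definition lambda_hom_skew_left_brace : Prop :=
  skew_left_brace /\ lambda_homomorphic.

Definition lambda_anti_hom_weak_left_brace : Prop :=
  weak_left_brace /\ lambda_anti_homomorphic.

Definition lambda_anti_hom_skew_left_brace : Prop :=
  skew_left_brace /\ lambda_anti_homomorphic.

Definition symmetric_weak_left_brace : Prop :=
  [/\ inverse_semigroup add, inverse_semigroup mul,
      forall x y z, x * (y + z) = x * y - x + x * z &
      forall x y z, x + y * z = (x + y) * x^-1 * (x + z)].

Definition symmetric_skew_left_brace : Prop :=
  [/\ symmetric_weak_left_brace, is_group add & is_group mul].

End TwoOperations.

(* The data (Y; B_a; phi_{a,b}); [ss_map] is phi_{a,b}, defined for b <= a. *)
Record brace_system (d : Order.disp_t) (Y : meetSemilatticeType d) :=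
  BraceSystem {
    ss_comp : Y -> Type;
    ss_add : forall a, binop (ss_comp a);
    ss_mul : forall a, binop (ss_comp a);
    ss_brace : forall a, skew_left_brace (@ss_add a) (@ss_mul a);
    ss_map : forall a b, b <= a -> ss_comp a -> ss_comp b;
    ss_map_add : forall a b (le_ba : b <= a) x y,
      ss_map le_ba (ss_add x y) = ss_add (ss_map le_ba x) (ss_map le_ba y);
    ss_map_mul : forall a b (le_ba : b <= a) x y,
      ss_map le_ba (ss_mul x y) = ss_mul (ss_map le_ba x) (ss_map le_ba y);
    ss_map_id : forall a (le_aa : a <= a) x, ss_map le_aa x = x;
    ss_map_comp : forall a b c (le_ba : b <= a) (le_cb : c <= b)
        (le_ca : c <= a) x,
      ss_map le_cb (ss_map le_ba x) = ss_map le_ca x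
  }.

Section StrongSemilattice.
Variables (d : Order.disp_t) (Y : meetSemilatticeType d) (X : brace_system Y).

(* The union of the pairwise disjoint B_a is the tagged sum. *)
Definition ss_carrier : Type := {a : Y & ss_comp X a}.

Definition ss_op (op : forall a, binop (ss_comp X a)) : binop ss_carrier :=
  fun u v =>
    existT (ss_comp X) (tag u `&` tag v)
      (op _ (ss_map (leIl (tag u) (tag v)) (tagged u))
            (ss_map (leIr (tag v) (tag u)) (tagged v))).

End StrongSemilattice.

(* [S] is the union of the B_a via the bijection [f], which carries the
   operations of [Y; B_a; phi_{a,b}] to those of [S]. *)
Definition strong_semilattice_of
    (P : forall T : Type, binop T -> binop T -> Prop)
    (S : Type) (add mul : binop S) : Prop :=
  exists (d : Order.disp_t) (Y : meetSemilatticeType d) (X : brace_system Y),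
    (forall a, P (ss_comp X a) (@ss_add _ _ X a) (@ss_mul _ _ X a)) /\
    exists f : ss_carrier X -> S,
      [/\ bijective f,
          {morph f : u v / ss_op (@ss_add _ _ X) u v >-> add u v} &
          {morph f : u v / ss_op (@ss_mul _ _ X) u v >-> mul u v}].

(* Main.v *)
(* In a weak left brace the additive and multiplicative idempotents coincide, and
   e * f = e + f for idempotents.  Computing the right unit of e * (e + z) in two
   ways gives e + (- z + e + z) = e - z + z, which forces additive idempotents to
   be central.  If moreover x^-1 * x = x * x^-1, multiplicative idempotents are
   central too; then x * e = x + e, the set where - x + x = e is a skew left brace
   with identity e, and translation by a smaller idempotent connects these braces
   into a strong semilattice.  Under the lambda hypotheses x^-1 * x = x * x^-1
   because lambda is also a morphism on (S, mul).  The symmetric axioms are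
   self-dual under exchanging the operations; they imply x + x * x^-1 = x, hence
   x * x^-1 = x * (x^-1 + x^-1 * x) = - x + x, and dually x^-1 * x = x - x.
   Conversely, all the axioms are regular identities (same variables on both
   sides), and these pass from the components to a strong semilattice because
   both sides can be projected to the same component. *)
From HB Require Import structures.
From mathcomp Require Import all_boot all_order boolp.
From Stdlib Require Import ClassicalEpsilon.
Require Import Defs.
Set Implicit Arguments.
Unset Strict Implicit.
Unset Printing Implicit Defensive.
Import Order.TTheory.
Local Open Scope order_scope.

Definition idempotent_elt (T : Type) (op : binop T) (e : T) := op e e = e.

Definition central_elt (T : Type) (op : binop T) (e : T) :=
  forall x, op e x = op x e.

(** * Inverse semigroups *)

Section InverseSemigroup.
Variables (T : Type) (op : binop T).
Hypothesis opI : inverse_semigroup op.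
Local Notation "x * y" := (op x y).
Local Notation "x ^-1" := (sinv op x).
Local Notation idem := (idempotent_elt op).

Lemma invsgA : associative op. Proof. by case: opI. Qed.

Lemma sinvP a : is_inverse_of op a a^-1.
Proof. by apply: epsilon_spec; case: opI => _ /(_ a) [b [ab _]]; exists b. Qed.

Lemma sinv_unique a b : is_inverse_of op a b -> a^-1 = b.
Proof.
case: opI => _ /(_ a) [c [_ c_uniq]] ab.
by rewrite -(c_uniq _ ab) -(c_uniq _ (sinvP a)).
Qed.

Lemma mulgVg a : a * (a^-1 * a) = a.
Proof. by case: (sinvP a); rewrite -invsgA. Qed.

Lemma mulVgV a : a^-1 * (a * a^-1) = a^-1.
Proof. by case: (sinvP a); rewrite -!invsgA. Qed.

Lemma sinvK a : a^-1^-1 = a.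
Proof. by apply: sinv_unique; case: (sinvP a). Qed.

Lemma sinv_idem e : idem e -> e^-1 = e.
Proof. by move=> ee; apply: sinv_unique; split; rewrite !ee. Qed.

Lemma idem_mulgV a : idem (a * a^-1).
Proof. by rewrite /idempotent_elt -invsgA mulVgV. Qed.

Lemma idem_mulVg a : idem (a^-1 * a).
Proof. by rewrite /idempotent_elt -invsgA mulgVg. Qed.

(** With [x = (e * f)^-1], the element [f * x * e] is also an inverse of [e * f], so
    [x = f * x * e]. This makes [x] idempotent, hence equal to its own inverse [e * f]. *)
Lemma idem_mul_closed e f : idem e -> idem f -> idem (e * f).
Proof.
move=> ee ff; set x := (e * f)^-1.
have [efx xef] := sinvP (e * f); rewrite -/x -!invsgA in efx xef.
have xE : x = f * (x * e).
  apply: sinv_unique; split; rewrite -!invsgA.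
    by rewrite [f * (f * _)]invsgA ff [e * (e * _)]invsgA ee.
  rewrite [e * (e * _)]invsgA ee [f * (f * _)]invsgA ff.
  by have /(congr1 (fun u => f * (u * e))) := xef; rewrite -!invsgA.
have xx : idem x.
  rewrite /idempotent_elt {1 2}xE -!invsgA.
  by have /(congr1 (fun u => f * (u * e))) := xef; rewrite -!invsgA => ->.
by have := sinv_idem xx; rewrite sinvK => ->.
Qed.

(** The idempotents [e * f] and [f * e] are mutually inverse, while each is its own inverse. *)
Lemma idem_comm e f : idem e -> idem f -> e * f = f * e.
Proof.
move=> ee ff.
have ef := idem_mul_closed ee ff; have fe := idem_mul_closed ff ee.
rewrite -(sinv_idem ef); apply: sinv_unique.
rewrite /idempotent_elt -!invsgA in ef fe.
by split; rewrite -!invsgA ?[f * (f * _)]invsgA ?ff ?[e * (e * _)]invsgA ?ee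
  ?[f * (f * _)]invsgA ?ff.
Qed.

Lemma sinvM a b : (a * b)^-1 = b^-1 * a^-1.
Proof.
have c := idem_comm (idem_mulgV b) (idem_mulVg a).
apply: sinv_unique; split.
  transitivity (a * ((b * b^-1) * (a^-1 * a)) * b); first by rewrite -!invsgA.
  by rewrite c -!invsgA mulgVg [a^-1 * (a * _)]invsgA invsgA mulgVg.
transitivity (b^-1 * ((a^-1 * a) * (b * b^-1)) * a^-1); first by rewrite -!invsgA.
by rewrite -c -!invsgA mulVgV [b * (b^-1 * _)]invsgA invsgA mulVgV.
Qed.

(** The hypothesis at [e * x] gives [x^-1 * e * x = e * (x * x^-1)]; multiplication by [x] on the
    left turns this into [e * x = x * e]. *)
Lemma commuting_inverses_idem_central :
  (forall x, x^-1 * x = x * x^-1) -> forall e, idem e -> central_elt op e.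
Proof.
move=> cliff e ee x; set f := x * x^-1.
have fe : f * e = e * f by apply: idem_comm ee; apply: idem_mulgV.
have ef : x^-1 * (e * x) = e * f.
  have := cliff (e * x); rewrite sinvM (sinv_idem ee) -!invsgA.
  by rewrite [e * (e * x)]invsgA ee [x * (x^-1 * e)]invsgA -/f fe
    [e * (e * f)]invsgA ee.
have fx : f * x = x by rewrite /f -invsgA mulgVg.
have xf : x * f = x by rewrite /f -cliff mulgVg.
transitivity (x * (x^-1 * (e * x))); last by rewrite ef -fe invsgA xf.
by rewrite invsgA -/f invsgA fe -invsgA fx.
Qed.
End InverseSemigroup.

Lemma morph_sinv (T U : Type) (op : binop T) (op' : binop U) (h : T -> U) :
  inverse_semigroup op -> inverse_semigroup op' ->
  {morph h : x y / op x y >-> op' x y} ->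
  forall x, h (sinv op x) = sinv op' (h x).
Proof.
move=> opI opI' hM x; apply/esym; apply: (sinv_unique opI').
by case: (sinvP opI x) => e1 e2; split; rewrite -!hM ?e1 ?e2.
Qed.

(** * Weak left braces *)

Section Brace.
Variables (T : Type) (add mul : binop T).
Local Notation "x + y" := (add x y).
Local Notation "- x" := (sinv add x).
Local Notation "x - y" := (add x (sinv add y)).
Local Notation "x * y" := (mul x y).
Local Notation "x ^-1" := (sinv mul x).
Local Notation lambda := (lambda add mul).
Local Notation idem := (idempotent_elt add).

Hypotheses (addI : inverse_semigroup add) (mulI : inverse_semigroup mul).
Hypothesis braceD : forall x y z, x * (y + z) = x * y - x + x * z.

Let addA := invsgA addI.
Let mulA := invsgA mulI.

(** Stated before the unit law, so that it can serve to derive that law for symmetric braces. With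
    [p = e * f] and [q = e + f], both [q * e] and [q * f] equal [p], and expanding [q * (e + f)]
    gives [q = p]. *)
Lemma idem_mul_add :
  (forall e, idem e <-> idempotent_elt mul e) ->
  forall e f, idem e -> idem f -> e * f = e + f.
Proof.
move=> idemE e f ee ff; set p := e * f.
have pC : p = f * e by apply: (idem_comm mulI); apply/idemE.
have pp : idem p.
  by apply/idemE; apply: (idem_mul_closed mulI); apply/idemE.
(* The brace law for [a * (b + b)] reads [p = p - a + p]. *)
have absorb a b : idem a -> idem b -> a * b = p -> p + a = p.
  move=> aa bb ab; have := braceD a b b; rewrite bb ab (sinv_idem addI aa).
  by rewrite (idem_comm addI pp aa) -addA pp.
have pe : p + e = p by apply: absorb ff _.
have pf : p + f = p by apply: absorb ee _.
set q := e + f.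
have qq : idempotent_elt mul q by apply/idemE; apply: (idem_mul_closed addI).
have eq : e * q = p.
  have /idemE mee := ee.
  by rewrite braceD (sinv_idem addI ee) mee ee -/p (idem_comm addI ee pp).
have fq : f * q = p.
  have /idemE mff := ff.
  by rewrite braceD (sinv_idem addI ff) mff -pC -addA ff pf.
have /idemE qa := qq.
have qe : q * e = p by rewrite -eq; apply: (idem_comm mulI) qq _; apply/idemE.
have qf : q * f = p by rewrite -fq; apply: (idem_comm mulI) qq _; apply/idemE.
rewrite -[RHS]qq {2}/q braceD qe qf (sinv_idem addI qa) /q addA pe pf.
exact: esym pp.
Qed.

Lemma lambdaD x : {morph lambda x : y z / y + z}.
Proof. by move=> y z; rewrite /lambda braceD -!addA. Qed.

Lemma lambdaN x y : lambda x (- y) = - lambda x y.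
Proof. exact: (morph_sinv addI addI (lambdaD x)). Qed.

Hypothesis mulxV : forall x, x * x^-1 = - x + x.

Lemma brace_idemE e : idem e <-> idempotent_elt mul e.
Proof.
split=> ee.
  have <- : e * e^-1 = e by rewrite mulxV (sinv_idem addI ee).
  exact: idem_mulgV.
have <- : - e + e = e by rewrite -mulxV (sinv_idem mulI ee).
exact: idem_mulVg.
Qed.

Let mulE := idem_mul_add brace_idemE.

(** Both sides are [lambda e (- z + z)]: since [lambda e u = e * (e + u)], additivity gives the left
    side, and products of idempotents being sums gives the right side. *)
Lemma conj_idem_bound e z : idem e -> e + (- z + (e + z)) = e + (- z + z).
Proof.
move=> ee; have me : e * e = e by apply/brace_idemE.
have Ne := sinv_idem addI ee.
have lamE u : lambda e u = e * (e + u).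
  by rewrite /lambda braceD me Ne ee.
set t := - z + (e + z).
have tE : (e + z) * (e + z)^-1 = t.
  by rewrite mulxV (sinvM addI) Ne -addA [e + (e + z)]addA ee.
have tt : idem t by apply/brace_idemE; rewrite -tE; apply: idem_mulgV.
have ff := idem_mulVg addI z.
have : lambda e (- z + z) = e + t.
  rewrite lambdaD lambdaN lamE -mulxV (sinvM mulI).
  rewrite (sinv_idem mulI me) -mulA [(e + z) * _]mulA tE mulE //.
    by rewrite mulE // (idem_comm addI tt ee) addA ee.
  by apply/brace_idemE; apply: idem_mul_closed => //; apply/brace_idemE.
by rewrite /lambda Ne mulE // addA ee => <-.
Qed.

(** The bound at [z], conjugated by [z], puts [p] below [e + g]; the bound at [- z] gives
    [e + p = e + g]. Hence [p = e + g], and adding [z] on the right gives centrality. *)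
Lemma brace_add_central e : idem e -> central_elt add e.
Proof.
move=> ee z; set f := - z + z; set g := z - z; set p := z + (e - z).
have ff : idem f by apply: idem_mulVg.
have gg : idem g by apply: idem_mulgV.
have gz : g + z = z by rewrite /g -addA mulgVg.
have eC u : idem u -> e + u = u + e by apply: idem_comm.
have zfe : z + (e + f) = z + e by rewrite (eC _ ff) addA /f mulgVg.
have p1 : p + (e + g) = p.
  have /(congr1 (fun u => z + (u - z))) := conj_idem_bound z ee.
  rewrite -!addA => H; rewrite /p /g -?addA H.
  by rewrite [- z + (z - z)]addA -/f [e + (f - z)]addA addA zfe -addA.
have p2 : e + p = e + g by have := conj_idem_bound (- z) ee; rewrite sinvK.
have pp : idem p.
  rewrite /idempotent_elt /p -!addA [- z + (z + _)]addA -/f [e + (f + _)]addA.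
  rewrite (eC _ ff) -addA [e + (e - z)]addA ee [f + _]addA addA [z + (f + e)]addA.
  by rewrite [z + f](mulgVg addI) -addA.
have pg : p + g = p.
  by rewrite (idem_comm addI pp gg) /p addA gz.
have pE : p = e + g.
  by rewrite -p2 -[LHS]p1 (eC _ gg) addA pg (eC _ pp).
have -> : z + e = p + z by rewrite -zfe -!addA.
by rewrite pE -addA gz.
Qed.

(** Centrality of [y - y] makes [- y + y] absorb it; taking [y = x] and [y = - x], the two
    idempotents absorb each other. *)
Lemma brace_addxN x : x - x = - x + x.
Proof.
have c y : (- y + y) + (y - y) = - y + y.
  rewrite -addA -(brace_add_central (idem_mulgV addI y) y).
  by rewrite -[y - y + y]addA mulgVg.
have := c (- x); rewrite sinvK // => <-.
rewrite (idem_comm addI); [exact: c | exact: idem_mulgV | exact: idem_mulVg].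
Qed.

(** The idempotent [(x * y) * (x * y)^-1] absorbs [x * x^-1], and by the unit law these are the
    additive right units of [x * y] and [x]. *)
Lemma mul_addr_idem x y : x * y + (- x + x) = x * y.
Proof.
have le : (- (x * y) + x * y) * (- x + x) = - (x * y) + x * y.
  by rewrite -!mulxV (sinvM mulI) -!mulA mulVgV.
rewrite mulE in le; [|exact: idem_mulVg..].
by rewrite -{1}[x * y](mulgVg addI) -addA le mulgVg.
Qed.

Lemma add_lambda x y : x + lambda x y = x * y.
Proof.
rewrite /lambda addA brace_addxN.
by rewrite (brace_add_central (idem_mulVg addI x)) mul_addr_idem.
Qed.

Lemma lambdaM x y : lambda x \o lambda y =1 lambda (x * y).
Proof.
move=> z; rewrite /comp [lambda y z]/Defs.lambda lambdaD lambdaN /lambda.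
rewrite (sinvM addI) sinvK // -addA [x + (- x + _)]addA brace_addxN mulA.
by rewrite (brace_add_central (idem_mulVg addI x)) -[x * y * z]mulA mul_addr_idem.
Qed.

Lemma lambda_idem_idem e f : idem e -> idem f -> lambda e f = e + f.
Proof.
by move=> ee ff; rewrite /lambda (sinv_idem addI ee) mulE // addA ee.
Qed.

(* [lambda] is a morphism on [(T, mul)]; the hypothesis makes idempotents central
   in its image, so [lambda (x^-1 * x)] and [lambda (x * x^-1)] coincide, and
   [lambda] is injective on idempotents. *)
Lemma lambda_idem_comm_dual :
  (forall e x, idem e -> lambda e \o lambda x =1 lambda x \o lambda e) ->
  forall x, x^-1 * x = x * x^-1.
Proof.
move=> lamC x; set f := x * x^-1; set h := x^-1 * x.
have fi : idem f by apply/brace_idemE; apply: idem_mulgV.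
have hi : idem h by apply/brace_idemE; apply: idem_mulVg.
have lM u v z : lambda u (lambda v z) = lambda (u * v) z by apply: lambdaM.
have lam_conj e u v z : idem e -> lambda (u * (e * v)) z = lambda (e * (u * v)) z.
  by move=> ee; rewrite -!lM; apply/esym; apply: (lamC e u ee).
have lamf z : lambda f z = lambda (h * f) z.
  have <- := lam_conj h x x^-1 z hi; congr (lambda _ z).
  by rewrite /h -mulA mulVgV.
have lamh z : lambda h z = lambda (h * f) z.
  have -> : h * f = f * h by apply: (idem_comm mulI); apply/brace_idemE.
  have <- := lam_conj f x^-1 x z fi; congr (lambda _ z).
  by rewrite /f -mulA mulgVg.
have eqfh z : lambda f z = lambda h z by rewrite lamf lamh.
have := eqfh h; have := eqfh f; rewrite !lambda_idem_idem // fi hi => fE hE.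
by rewrite -[LHS]hE (idem_comm addI).
Qed.
End Brace.

(** * Symmetric weak left braces *)

Section SymmetricBrace.
Variables (T : Type) (add mul : binop T).
Local Notation "x + y" := (add x y).
Local Notation "- x" := (sinv add x).
Local Notation "x - y" := (add x (sinv add y)).
Local Notation "x * y" := (mul x y).
Local Notation "x ^-1" := (sinv mul x).

(** The exchange swaps the two axioms, so each later fact comes with its dual. *)
Lemma symmetric_weak_left_braceC :
  symmetric_weak_left_brace add mul -> symmetric_weak_left_brace mul add.
Proof. by case. Qed.

(** With all variables equal to [e], the symmetric law gives [e + p = e] and then the brace law
    gives [p = p + e]. So [p] is an additive idempotent, commutes with [e], and equals it. *)
Lemma symmetric_idem e :
  symmetric_weak_left_brace add mul ->
  idempotent_elt add e -> idempotent_elt mul e.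
Proof.
case=> addI mulI braceD symD ee; have addA := invsgA addI.
set p := e * e.
have e1 : e + p = e by rewrite symD ee -(invsgA mulI) mulgVg.
have e2 : p = p + e.
  by have := braceD e e e; rewrite ee (sinv_idem addI ee) -/p -addA e1.
have pp : idempotent_elt add p by rewrite /idempotent_elt {1}e2 -addA e1 -e2.
by rewrite /idempotent_elt -/p -[RHS]e1 (idem_comm addI ee pp).
Qed.
End SymmetricBrace.

Lemma symmetric_idemE (T : Type) (add mul : binop T) e :
  symmetric_weak_left_brace add mul ->
  (idempotent_elt add e <-> idempotent_elt mul e).
Proof.
move=> symS; split; first exact: symmetric_idem.
by apply: symmetric_idem; apply: symmetric_weak_left_braceC.
Qed.

Lemma symmetric_mulxV (T : Type) (add mul : binop T) x :
  symmetric_weak_left_brace add mul ->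
  mul x (sinv mul x) = add (sinv add x) x.
Proof.
move=> symS; have idemE e := symmetric_idemE e symS.
case: symS => addI mulI braceD symD.
have addA := invsgA addI; have mulA := invsgA mulI.
have bound y : add y (mul y (sinv mul y)) = y.
  set k := mul y _; set f := add (sinv add y) y.
  have ff : idempotent_elt add f by apply: idem_mulVg.
  have kk : idempotent_elt add k by apply/idemE; apply: idem_mulgV.
  have yf : add y f = y by apply: mulgVg.
  (* The left side is [y + f = y]; the right side is [k * (y + f)], which the brace law reduces to
     [y + k]. *)
  have := symD y f f; rewrite {1}yf -/k braceD (sinv_idem addI kk).
  have /idemE -> := ff; rewrite (idem_mul_add addI mulI braceD idemE kk ff).
  have -> : mul k y = y by rewrite -mulA mulgVg.
  rewrite yf -addA [add k (add k f)]addA kk.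
  by rewrite (idem_comm addI kk ff) addA yf.
rewrite -{1}[sinv mul x]bound sinvK // braceD mulgVg //.
rewrite -addA (idem_comm addI); last exact: idem_mulVg.
  by rewrite -addA bound.
by apply/idemE; apply: idem_mulgV.
Qed.

Lemma symmetric_weak_left_brace_weak (T : Type) (add mul : binop T) :
  symmetric_weak_left_brace add mul -> weak_left_brace add mul.
Proof.
move=> symS; have xV x := symmetric_mulxV x symS.
by case: symS => *; split.
Qed.

(** The added condition makes the multiplicative semigroup Clifford. All three classes reduce to
    this one for the decomposition. *)
Definition dual_weak_left_brace (T : Type) (add mul : binop T) :=
  weak_left_brace add mul /\
  forall x, mul (sinv mul x) x = mul x (sinv mul x).

Lemma symmetric_dual (T : Type) (add mul : binop T) :
  symmetric_weak_left_brace add mul -> dual_weak_left_brace add mul.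
Proof.
move=> symS; have weakS := symmetric_weak_left_brace_weak symS.
split=> // x.
rewrite -(symmetric_mulxV x (symmetric_weak_left_braceC symS)).
by case: weakS => addI mulI braceD xV; rewrite xV (brace_addxN addI mulI).
Qed.

(** Additive idempotents are central, so [e + x = x + e], which the hypothesis turns into
    commutation of [lambda e] with [lambda x]. *)
Lemma lambda_homomorphic_dual (T : Type) (add mul : binop T) :
  lambda_hom_weak_left_brace add mul -> dual_weak_left_brace add mul.
Proof.
case=> weakS lamS; split=> //; case: weakS => addI mulI braceD xV.
apply: (lambda_idem_comm_dual addI mulI braceD xV) => // e x ee z.
by rewrite !lamS (brace_add_central addI mulI braceD xV ee).
Qed.

Lemma lambda_anti_homomorphic_dual (T : Type) (add mul : binop T) :
  lambda_anti_hom_weak_left_brace add mul -> dual_weak_left_brace add mul.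
Proof.
case=> weakS lamS; split=> //; case: weakS => addI mulI braceD xV.
apply: (lambda_idem_comm_dual addI mulI braceD xV) => // e x ee z.
by rewrite !lamS (brace_add_central addI mulI braceD xV ee).
Qed.

(** * Identities *)

(** With axioms as formal identities, their transfer to components and back is proved once for all
    of them. *)
Inductive brace_term :=
  | Var of nat
  | Add of brace_term & brace_term
  | Mul of brace_term & brace_term
  | Opp of brace_term
  | Inv of brace_term.

Fixpoint term_vars t : seq nat :=
  match t with
  | Var i => [:: i]
  | Add s t | Mul s t => term_vars s ++ term_vars t
  | Opp t | Inv t => term_vars t
  end.

(** Regular identities in the sense of universal algebra; a strong semilattice is a Plonka sum,
    which preserves them. *)
Definition regular (st : brace_term * brace_term) :=
  all [in term_vars st.2] (term_vars st.1) &&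
  all [in term_vars st.1] (term_vars st.2).

Section Eval.
Variables (T : Type) (add mul : binop T).

Fixpoint eval (env : nat -> T) t : T :=
  match t with
  | Var i => env i
  | Add s t => add (eval env s) (eval env t)
  | Mul s t => mul (eval env s) (eval env t)
  | Opp t => sinv add (eval env t)
  | Inv t => sinv mul (eval env t)
  end.

Definition satisfies (st : brace_term * brace_term) : Prop :=
  forall env, eval env st.1 = eval env st.2.

End Eval.

Lemma morph_eval (T U : Type) (add mul : binop T) (add' mul' : binop U)
    (h : T -> U) :
  inverse_semigroup add -> inverse_semigroup mul ->
  inverse_semigroup add' -> inverse_semigroup mul' ->
  {morph h : x y / add x y >-> add' x y} ->
  {morph h : x y / mul x y >-> mul' x y} ->
  forall env t, h (eval add mul env t) = eval add' mul' (h \o env) t.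
Proof.
move=> addI mulI addI' mulI' hD hM env.
elim=> //= [s <- t <-|s <- t <-|t <-|t <-] //.
  exact: morph_sinv.
exact: morph_sinv.
Qed.

(** Identities pass to subalgebras; used for components inside [S] and for the bijection with a
    strong semilattice. *)
Lemma satisfies_sub (T U : Type) (add mul : binop T) (add' mul' : binop U)
    (h : T -> U) st :
  inverse_semigroup add -> inverse_semigroup mul ->
  inverse_semigroup add' -> inverse_semigroup mul' ->
  {morph h : x y / add x y >-> add' x y} ->
  {morph h : x y / mul x y >-> mul' x y} ->
  injective h -> satisfies add' mul' st -> satisfies add mul st.
Proof.
move=> addI mulI addI' mulI' hD hM h_inj sat' env.
by apply: h_inj; rewrite !(morph_eval addI mulI addI' mulI' hD hM).
Qed.

(** * The axioms as formal identities *)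

Local Notation "''x'" := (Var 0).
Local Notation "''y'" := (Var 1).
Local Notation "''z'" := (Var 2).

Definition brace_law :=
  (Mul 'x (Add 'y 'z), Add (Add (Mul 'x 'y) (Opp 'x)) (Mul 'x 'z)).

Definition unit_law := (Mul 'x (Inv 'x), Add (Opp 'x) 'x).

Definition symmetric_law :=
  (Add 'x (Mul 'y 'z), Mul (Mul (Add 'x 'y) (Inv 'x)) (Add 'x 'z)).

Definition lambda_term s t := Add (Opp s) (Mul s t).

Definition lambda_hom_law :=
  (lambda_term 'x (lambda_term 'y 'z), lambda_term (Add 'x 'y) 'z).

Definition lambda_anti_hom_law :=
  (lambda_term 'y (lambda_term 'x 'z), lambda_term (Add 'x 'y) 'z).

Definition env3 (T : Type) (x y z : T) i := nth x [:: x; y; z] i.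

Section Laws.
Variables (T : Type) (add mul : binop T).

Lemma weak_left_brace_satisfies :
  weak_left_brace add mul <->
  [/\ inverse_semigroup add, inverse_semigroup mul,
      satisfies add mul brace_law & satisfies add mul unit_law].
Proof.
split=> -[addI mulI braceD xV]; split=> //.
- by move=> env; apply: braceD.
- by move=> env; apply: xV.
- by move=> x y z; apply: (braceD (env3 x y z)).
- by move=> x; apply: (xV (env3 x x x)).
Qed.

Lemma symmetric_weak_left_brace_satisfies :
  symmetric_weak_left_brace add mul <->
  [/\ inverse_semigroup add, inverse_semigroup mul,
      satisfies add mul brace_law & satisfies add mul symmetric_law].
Proof.
split=> -[addI mulI braceD symD]; split=> //.
- by move=> env; apply: braceD.
- by move=> env; apply: symD.
- by move=> x y z; apply: (braceD (env3 x y z)).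
- by move=> x y z; apply: (symD (env3 x y z)).
Qed.

Lemma lambda_homomorphic_satisfies :
  lambda_homomorphic add mul <-> satisfies add mul lambda_hom_law.
Proof.
split=> [lamH env|sat x y z]; first exact: lamH.
exact: (sat (env3 x y z)).
Qed.

Lemma lambda_anti_homomorphic_satisfies :
  lambda_anti_homomorphic add mul <-> satisfies add mul lambda_anti_hom_law.
Proof.
split=> [lamH env|sat x y z]; first exact: lamH.
exact: (sat (env3 x y z)).
Qed.
End Laws.

Lemma group_inverse_semigroup (T : Type) (op : binop T) :
  is_group op -> inverse_semigroup op.
Proof.
case=> opA [e [e1 e2 opV]]; split=> // a.
have [b [ba ab]] := opV a; exists b; split; first by rewrite /is_inverse_of ab ba.
move=> c [aca _].
have := congr1 (op b) aca; rewrite -!opA opA ba e1 => ca.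
by have := congr1 (op^~ b) ca; rewrite -opA ab e1 e2.
Qed.

(** * Decomposition of dual weak left braces *)

(* The unused argument lets the semilattice instance below be inferred. *)
Definition idem_type (S : Type) (add mul : binop S)
  & dual_weak_left_brace add mul := {e : S | idempotent_elt add e}.

Section Decomposition.
Variables (S : Type) (add mul : binop S).
Hypothesis dualS : dual_weak_left_brace add mul.
Local Notation "x + y" := (add x y).
Local Notation "- x" := (sinv add x).
Local Notation "x - y" := (add x (sinv add y)).
Local Notation "x * y" := (mul x y).
Local Notation "x ^-1" := (sinv mul x).
Local Notation idem := (idempotent_elt add).

Let addI : inverse_semigroup add. Proof. by case: dualS => -[]. Qed.
Let mulI : inverse_semigroup mul. Proof. by case: dualS => -[]. Qed.
Let braceD x y z : x * (y + z) = x * y - x + x * z.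
Proof. by case: dualS => -[]. Qed.
Let mulxV x : x * x^-1 = - x + x. Proof. by case: dualS => -[]. Qed.
Let mulVx x : x^-1 * x = x * x^-1. Proof. by case: dualS. Qed.
Let addA := invsgA addI.
Let mulA := invsgA mulI.
Let addxN := brace_addxN addI mulI braceD mulxV.
Let addC e x : idem e -> e + x = x + e.
Proof. by move=> ee; apply: (brace_add_central addI mulI). Qed.
Let idemE e : idem e <-> idempotent_elt mul e.
Proof. exact: brace_idemE. Qed.
Let mulC e x : idem e -> e * x = x * e.
Proof. by move=> /idemE ee; apply: commuting_inverses_idem_central. Qed.
Let mulE e f : idem e -> idem f -> e * f = e + f.
Proof. by apply: idem_mul_add; [..|exact: idemE]. Qed.

(** This idempotent also equals [x - x], [x * x^-1] and [x^-1 * x]; it labels the component of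
    [x]. *)
Definition unit_of x := - x + x.

Lemma unit_of_idem x : idem (unit_of x). Proof. exact: idem_mulVg. Qed.

Lemma unit_of_id e : idem e -> unit_of e = e.
Proof. by move=> ee; rewrite /unit_of sinv_idem. Qed.

Lemma unit_ofD x y : unit_of (x + y) = unit_of x + unit_of y.
Proof.
have ux := unit_of_idem x; rewrite {1}/unit_of sinvM // -addA.
rewrite [- x + (x + y)]addA -/(unit_of x) (addC y ux) addA.
by rewrite -/(unit_of y) -addC.
Qed.

Lemma unit_ofM x y : unit_of (x * y) = unit_of x + unit_of y.
Proof.
have uy := unit_of_idem y; have ux := unit_of_idem x.
rewrite {1}/unit_of -mulxV sinvM // -mulA [y * (y^-1 * _)]mulA mulxV.
by rewrite -/(unit_of y) (mulC _ uy) mulA mulxV mulE.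
Qed.

Lemma unit_ofN x : unit_of (- x) = unit_of x.
Proof. by rewrite /unit_of sinvK. Qed.

Lemma unit_ofV x : unit_of x^-1 = unit_of x.
Proof. by rewrite /unit_of -!mulxV sinvK // mulVx. Qed.

Lemma addxu x : x + unit_of x = x. Proof. exact: mulgVg. Qed.

Lemma mulxu x : x * unit_of x = x.
Proof. by rewrite /unit_of -mulxV -mulVx mulgVg. Qed.

(** Here [x * e = x + y] with [y = lambda x e] idempotent, hence equal to its own unit, which is
    [unit_of x + e]; then [x] absorbs [unit_of x]. *)
Lemma mulx_idem x e : idem e -> x * e = x + e.
Proof.
move=> ee; have ux := unit_of_idem x.
rewrite -(add_lambda addI mulI braceD mulxV); set y := lambda _ _ x e.
have yy : idem y by rewrite /idempotent_elt -lambdaD // ee.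
rewrite -[y]unit_of_id // unit_ofD unit_ofN unit_ofM (unit_of_id ee).
by rewrite [unit_of x + (_ + _)]addA ux addA addxu.
Qed.

Local Notation Y := (idem_type dualS).

HB.instance Definition _ := gen_eqMixin Y.
HB.instance Definition _ := gen_choiceMixin Y.

Lemma idem_type_inj (e f : Y) : sval e = sval f -> e = f.
Proof. exact: eq_sig_hprop. Qed.

Definition idem_le (e f : Y) : bool := `[< sval e + sval f = sval e >].

Lemma idem_le_refl : reflexive idem_le.
Proof. by move=> e; apply/asboolP; apply: (svalP e). Qed.

Lemma idem_le_anti : antisymmetric idem_le.
Proof.
move=> e f /andP[/asboolP ef /asboolP fe]; apply: idem_type_inj.
by rewrite -[LHS]ef (addC _ (svalP e)).
Qed.

Lemma idem_le_trans : transitive idem_le.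
Proof.
move=> f e g /asboolP ef /asboolP fg; apply/asboolP.
by rewrite -ef -addA fg.
Qed.

HB.instance Definition _ :=
  Order.Le_isPOrder.Build (Order.Disp tt tt) Y
    idem_le_refl idem_le_anti idem_le_trans.

Definition idem_meet (e f : Y) : Y :=
  exist _ (sval e + sval f) (idem_mul_closed addI (svalP e) (svalP f)).

Lemma idem_leI (e f g : Y) :
  (e <= idem_meet f g) = (e <= f) && (e <= g).
Proof.
apply/asboolP/andP => /=.
  rewrite addA => efg; split; apply/asboolP; rewrite -efg.
    rewrite -!addA -(addC (sval g) (svalP f)) [sval f + (_ + _)]addA.
    by rewrite (svalP f).
  by rewrite -!addA (svalP g).
by case=> /asboolP ef /asboolP eg; rewrite addA ef eg.
Qed.

HB.instance Definition _ :=
  Order.POrder_isMeetSemilattice.Build (Order.Disp tt tt) Y idem_leI.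

Lemma add_idem_morph e x y : idem e -> x + y + e = x + e + (y + e).
Proof.
move=> ee; rewrite -!addA; congr (_ + _).
by rewrite [e + _]addA (addC y ee) -addA ee.
Qed.

(** By [mulx_idem], adding [e] is multiplying by the central idempotent [e], so one translation
    respects both operations. *)
Lemma mul_idem_morph e x y : idem e -> x * y + e = (x + e) * (y + e).
Proof.
move=> ee; have /idemE me := ee; rewrite -!mulx_idem // -!mulA; congr (_ * _).
by rewrite [e * _]mulA (mulC y ee) -mulA me.
Qed.

(** The maximal subgroup at [e], the same for both operations. *)
Definition component (e : Y) := {x : S | unit_of x = sval e}.

Lemma component_inj e : injective (fun x : component e => sval x).
Proof. by move=> x y; apply: eq_sig_hprop. Qed.

Lemma component_addu e (x : component e) : sval x + sval e = sval x.
Proof. by case: x => x /= <-; apply: addxu. Qed.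

Lemma component_mulu e (x : component e) : sval x * sval e = sval x.
Proof. by case: x => x /= <-; apply: mulxu. Qed.

Definition component_add e (x y : component e) : component e.
Proof.
by exists (sval x + sval y); rewrite unit_ofD (svalP x) (svalP y) (svalP e).
Defined.

Definition component_mul e (x y : component e) : component e.
Proof.
by exists (sval x * sval y); rewrite unit_ofM (svalP x) (svalP y) (svalP e).
Defined.

Lemma component_add_group e : is_group (@component_add e).
Proof.
split; first by move=> x y z; apply: component_inj; rewrite /= addA.
exists (exist (fun x => unit_of x = _) _ (unit_of_id (svalP e))); split.
- move=> x; apply: component_inj => /=.
  by rewrite (addC _ (svalP e)) component_addu.
- by move=> x; apply: component_inj; apply: component_addu.
move=> x; have xN : unit_of (- sval x) = sval e by rewrite unit_ofN (svalP x).
exists (exist (fun x => unit_of x = _) _ xN).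
by split; apply: component_inj; rewrite /= ?addxN; apply: (svalP x).
Qed.

Lemma component_mul_group e : is_group (@component_mul e).
Proof.
split; first by move=> x y z; apply: component_inj; rewrite /= mulA.
exists (exist (fun x => unit_of x = _) _ (unit_of_id (svalP e))); split.
- move=> x; apply: component_inj => /=.
  by rewrite (mulC _ (svalP e)) component_mulu.
- by move=> x; apply: component_inj; apply: component_mulu.
move=> x; have xV : unit_of (sval x)^-1 = sval e by rewrite unit_ofV (svalP x).
exists (exist (fun x => unit_of x = _) _ xV).
by split; apply: component_inj; rewrite /= ?mulVx mulxV; apply: (svalP x).
Qed.

Lemma component_brace e : skew_left_brace (@component_add e) (@component_mul e).
Proof.
have addG := component_add_group e; have mulG := component_mul_group e.
have addI' := group_inverse_semigroup addG.
have mulI' := group_inverse_semigroup mulG.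
case: dualS => /weak_left_brace_satisfies[_ _ braceS unitS] _.
split=> //; apply/weak_left_brace_satisfies; split=> //.
  exact: (satisfies_sub addI' mulI' addI mulI) (@component_inj e) _.
exact: (satisfies_sub addI' mulI' addI mulI) (@component_inj e) _.
Qed.

(** The translated element has unit [e + f], which is [f] because [f <= e]. *)
Definition component_map (e f : Y) (le_fe : f <= e) (x : component e) :
  component f.
Proof.
exists (sval x + sval f); rewrite unit_ofD (svalP x) (unit_of_id (svalP f)).
by rewrite (addC _ (svalP e)); apply/asboolP.
Defined.

Definition component_system : brace_system Y.
Proof.
exists component component_add component_mul component_map.
- exact: component_brace.
- by move=> e f le_fe x y; apply: component_inj; apply: add_idem_morph (svalP f).
- by move=> e f le_fe x y; apply: component_inj; apply: mul_idem_morph (svalP f).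
- by move=> e le_ee x; apply: component_inj; apply: component_addu.
move=> e f g le_fe le_gf le_ge x; apply: component_inj => /=.
by have /asboolP gf := le_gf; rewrite -addA (addC _ (svalP f)) gf.
Defined.

(** Shared by the three cases: [P] is only asked of skew left braces that embed in [S]. *)
Lemma dual_strong_semilattice (P : forall T : Type, binop T -> binop T -> Prop) :
  (forall (T : Type) (addT mulT : binop T) (h : T -> S), injective h ->
     {morph h : x y / addT x y >-> x + y} ->
     {morph h : x y / mulT x y >-> x * y} ->
     skew_left_brace addT mulT -> P T addT mulT) ->
  strong_semilattice_of P add mul.
Proof.
move=> subP; exists (Order.Disp tt tt), Y, component_system; split=> [e|].
  exact: subP (@component_inj e) _ _ (component_brace e).
pose f (u : ss_carrier component_system) := sval (tagged u).
exists f; split.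
(* The inverse bijection puts [x] in the component of its own unit. *)
- exists (fun x => existT component (exist _ _ (unit_of_idem x))
                     (exist _ x erefl)) => //.
  case=> -[e ee] [x /= xe]; rewrite /f /=; case: e / xe in ee *.
  by rewrite (Prop_irrelevance (unit_of_idem x) ee).
(* Both arguments are translated by [unit_of (x + y)]; taken out of the sum, this unit is absorbed
   by [x + y]. *)
- case=> -[e ee] [x /= xe] [[g gg] [y /= yg]]; rewrite /f /= -xe -yg -unit_ofD.
  by rewrite -add_idem_morph ?addxu //; apply: unit_of_idem.
case=> -[e ee] [x /= xe] [[g gg] [y /= yg]]; rewrite /f /= -xe -yg -unit_ofM.
by rewrite -mul_idem_morph ?addxu //; apply: unit_of_idem.
Qed.

End Decomposition.

(** * Strong semilattices *)

Section StrongSemilattice.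
Variables (d : Order.disp_t) (Y : meetSemilatticeType d) (X : brace_system Y).
Implicit Types (a b c : Y) (u v w : ss_carrier X).

(* The junk value [x] makes the projection total, so that it can be applied to
   every entry of an environment in [ss_proj_eval]. *)
Definition ss_proj c (x : ss_comp X c) u : ss_comp X c :=
  if decP (@idP (c <= tag u)) is left le_cu then ss_map le_cu (tagged u) else x.

Lemma ss_projE c x u (le_cu : c <= tag u) :
  ss_proj x u = ss_map le_cu (tagged u).
Proof.
rewrite /ss_proj; case: decP => // le_cu'.
by rewrite (bool_irrelevance le_cu' le_cu).
Qed.

Lemma ss_proj_tagged a x (y : ss_comp X a) : ss_proj x (existT _ a y) = y.
Proof. by rewrite (ss_projE _ (lexx a : a <= tag (existT _ a y))) ss_map_id. Qed.

(** Projecting both elements to the component of [u] replaces a cast along the equality of tags. *)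
Lemma ss_carrier_eq u v :
  tag u = tag v -> ss_proj (tagged u) u = ss_proj (tagged u) v -> u = v.
Proof.
case: u v => [a x] [b y] /= ab; case: b / ab y => y.
by rewrite !ss_proj_tagged => ->.
Qed.

Section OneOperation.
Variable op : forall a, binop (ss_comp X a).
Hypothesis opG : forall a, is_group (@op a).
Hypothesis map_op : forall a b (le_ba : b <= a) x y,
  ss_map le_ba (op x y) = op (ss_map le_ba x) (ss_map le_ba y).

Let opI a : inverse_semigroup (@op a).
Proof. exact: group_inverse_semigroup. Qed.

(** By functoriality, passing through the meet of the tags and then to [c] is the direct map to
    [c]. *)
Lemma ss_proj_op c (x : ss_comp X c) u v : c <= tag u -> c <= tag v ->
  ss_proj x (ss_op op u v) = op (ss_proj x u) (ss_proj x v).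
Proof.
move=> cu cv; have cuv : c <= tag (ss_op op u v) by rewrite /= lexI cu.
rewrite (ss_projE _ cuv) map_op (ss_map_comp _ _ cu) (ss_map_comp _ _ cv).
by rewrite !(ss_projE x).
Qed.

Definition ss_inv u : ss_carrier X :=
  existT (ss_comp X) (tag u) (sinv (@op (tag u)) (tagged u)).

Lemma ss_proj_inv c (x : ss_comp X c) u : c <= tag u ->
  ss_proj x (ss_inv u) = sinv (@op c) (ss_proj x u).
Proof.
move=> cu; rewrite (ss_projE x (cu : c <= tag (ss_inv u))) (ss_projE x cu).
exact: (morph_sinv (@opI _) (@opI _) (map_op cu)).
Qed.

(** Both sides are compared in the component of the triple product, where the group law is
    associative. *)
Lemma ss_opA : associative (ss_op op).
Proof.
move=> u v w; apply: ss_carrier_eq; first by rewrite /= meetA.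
set x := tagged _; set c := tag _ in x *.
have [cu cv cw] : [/\ c <= tag u, c <= tag v & c <= tag w].
  by apply/and3P; rewrite -!lexI.
by rewrite !ss_proj_op ?lexI ?cu ?cv ?(proj1 (@opI _)).
Qed.

Lemma ss_inverse_of u : is_inverse_of (ss_op op) u (ss_inv u).
Proof.
split; (apply: ss_carrier_eq; first by rewrite /= !meetxx); set x := tagged _.
  have cu : tag u `&` tag u `&` tag u <= tag u by rewrite leIr.
  rewrite !ss_proj_op ?lexI ?cu // ss_proj_inv //.
  by case: (sinvP (@opI _) (ss_proj x u)).
have cu : tag u `&` tag u `&` tag u <= tag u by rewrite leIr.
rewrite !ss_proj_op ?lexI ?cu // ss_proj_inv //.
by case: (sinvP (@opI _) (ss_proj x u)).
Qed.

(** Each equation puts one tag below the other, so [v] lies in the component of [u], where inverses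
    are unique. *)
Lemma ss_inverse_unique u v : is_inverse_of (ss_op op) u v -> ss_inv u = v.
Proof.
case=> uvu vuv.
have uv : tag u = tag v.
  apply/le_anti; have /= <- := congr1 tag uvu; have /= <- := congr1 tag vuv.
  by rewrite !lexI !leIx2 ?lexx ?orbT.
have le_uv : tag u <= tag v by rewrite uv.
apply: ss_carrier_eq; first by [].
set x := tagged _; rewrite ss_proj_inv //.
apply: (sinv_unique (@opI _)); rewrite /is_inverse_of.
by rewrite -!ss_proj_op ?lexI ?lexx ?le_uv ?uvu ?vuv.
Qed.

Lemma ss_inverse_semigroup : inverse_semigroup (ss_op op).
Proof.
split=> [|u]; first exact: ss_opA.
by exists (ss_inv u); split; [exact: ss_inverse_of | exact: ss_inverse_unique].
Qed.

Lemma ss_sinv u : sinv (ss_op op) u = ss_inv u.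
Proof. by apply: (sinv_unique ss_inverse_semigroup); apply: ss_inverse_of. Qed.
End OneOperation.

Local Notation add := (ss_op (@ss_add _ _ X)).
Local Notation mul := (ss_op (@ss_mul _ _ X)).

Let addG a : is_group (@ss_add _ _ X a). Proof. by case: (ss_brace X a). Qed.
Let mulG a : is_group (@ss_mul _ _ X a). Proof. by case: (ss_brace X a). Qed.

Lemma ss_add_inverse_semigroup : inverse_semigroup add.
Proof. exact: ss_inverse_semigroup addG (@ss_map_add _ _ X). Qed.

Lemma ss_mul_inverse_semigroup : inverse_semigroup mul.
Proof. exact: ss_inverse_semigroup mulG (@ss_map_mul _ _ X). Qed.

(** Lower bounds stand in for the iterated meet of the variables' tags, as [Y] may have no greatest
    element to start it from. *)
Lemma le_tag_eval c env t :
  (c <= tag (eval add mul env t)) = all (fun i => c <= tag (env i)) (term_vars t).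
Proof.
elim: t => /= [i|s IHs t IHt|s IHs t IHt|t IHt|t IHt].
- by rewrite andbT.
- by rewrite lexI IHs IHt all_cat.
- by rewrite lexI IHs IHt all_cat.
- by rewrite (ss_sinv addG (@ss_map_add _ _ X)).
by rewrite (ss_sinv mulG (@ss_map_mul _ _ X)).
Qed.

(** A lower bound of the tag of a term is one for its subterms, so projection commutes with every
    operation met in the induction. *)
Lemma ss_proj_eval c (x : ss_comp X c) env t : c <= tag (eval add mul env t) ->
  ss_proj x (eval add mul env t) =
  eval (@ss_add _ _ X c) (@ss_mul _ _ X c) (ss_proj x \o env) t.
Proof.
elim: t => //= [s IHs t IHt|s IHs t IHt|t IHt|t IHt].
- rewrite lexI => /andP[cs ct].
  by rewrite (ss_proj_op (@ss_map_add _ _ X)) // IHs // IHt.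
- rewrite lexI => /andP[cs ct].
  by rewrite (ss_proj_op (@ss_map_mul _ _ X)) // IHs // IHt.
- rewrite (ss_sinv addG (@ss_map_add _ _ X)) => ct.
  by rewrite (ss_proj_inv addG (@ss_map_add _ _ X)) // IHt.
rewrite (ss_sinv mulG (@ss_map_mul _ _ X)) => ct.
by rewrite (ss_proj_inv mulG (@ss_map_mul _ _ X)) // IHt.
Qed.

(* Only identities with the same variables on both sides lift: the component of
   a value is the meet of the components of the variables. *)
Lemma ss_satisfies st : regular st ->
  (forall a, satisfies (@ss_add _ _ X a) (@ss_mul _ _ X a) st) ->
  satisfies add mul st.
Proof.
case/andP=> /allP sub12 /allP sub21 sat env.
have le_eval c :
    (c <= tag (eval add mul env st.1)) = (c <= tag (eval add mul env st.2)).
  rewrite !le_tag_eval; apply: eq_all_r => i.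
  by apply/idP/idP; [apply: sub12 | apply: sub21].
apply: ss_carrier_eq; first by apply/le_anti; rewrite le_eval lexx -le_eval lexx.
by rewrite !ss_proj_eval -?le_eval ?lexx ?sat.
Qed.

End StrongSemilattice.

(** * Transport along the bijection with a strong semilattice *)

Lemma inverse_semigroup_iso (T U : Type) (op : binop T) (op' : binop U)
    (h : T -> U) (g : U -> T) :
  cancel h g -> cancel g h -> {morph h : x y / op x y >-> op' x y} ->
  inverse_semigroup op -> inverse_semigroup op'.
Proof.
move=> hK gK hM opI.
have opE x y : op' x y = h (op (g x) (g y)) by rewrite hM !gK.
split=> [x y z|x]; first by rewrite !opE !hK (invsgA opI).
exists (h (sinv op (g x))); split.
  by rewrite /is_inverse_of !opE !hK; case: (sinvP opI (g x)) => -> ->; rewrite !gK.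
move=> y [xyx yxy]; rewrite -[y]gK; congr h; apply: (sinv_unique opI).
by split; apply: (can_inj hK); rewrite !hM !gK.
Qed.

Section SatisfiesStrongSemilattice.
Variables (P : forall T : Type, binop T -> binop T -> Prop).
Variables (S : Type) (add mul : binop S).
Hypothesis S_P : strong_semilattice_of P add mul.

Lemma strong_semilattice_inverse :
  inverse_semigroup add /\ inverse_semigroup mul.
Proof.
case: S_P => d [Y [X [_ [f [[g fK gK] fD fM]]]]]; split.
  exact: inverse_semigroup_iso fK gK fD (ss_add_inverse_semigroup X).
exact: inverse_semigroup_iso fK gK fM (ss_mul_inverse_semigroup X).
Qed.

(** The identity lifts from the components to the tagged union and is pulled back along the inverse
    bijection. *)
Lemma strong_semilattice_satisfies st : regular st ->
  (forall T (addT mulT : binop T), skew_left_brace addT mulT -> P addT mulT ->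
     satisfies addT mulT st) ->
  satisfies add mul st.
Proof.
move=> reg satP; have [addI mulI] := strong_semilattice_inverse.
case: S_P => d [Y [X [XP [f [[g fK gK] fD fM]]]]].
have gD : {morph g : x y / add x y >-> ss_op (@ss_add _ _ X) x y}.
  by move=> x y; apply: (can_inj fK); rewrite gK fD !gK.
have gM : {morph g : x y / mul x y >-> ss_op (@ss_mul _ _ X) x y}.
  by move=> x y; apply: (can_inj fK); rewrite gK fM !gK.
apply: (satisfies_sub addI mulI (ss_add_inverse_semigroup X)
  (ss_mul_inverse_semigroup X) gD gM (can_inj gK)).
by apply: ss_satisfies reg _ => a; apply: satP (ss_brace X a) (XP a).
Qed.

Lemma strong_semilattice_weak_left_brace : weak_left_brace add mul.
Proof.
have [addI mulI] := strong_semilattice_inverse.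
apply/weak_left_brace_satisfies; split=> //;
  apply: strong_semilattice_satisfies => // T addT mulT [] weakT _ _ _;
  by case/weak_left_brace_satisfies: weakT.
Qed.
End SatisfiesStrongSemilattice.

Theorem proposition4p9 (S : Type) (add mul : binop S) :
  (symmetric_weak_left_brace add mul <->
   strong_semilattice_of symmetric_skew_left_brace add mul) /\
  (lambda_hom_weak_left_brace add mul <->
   strong_semilattice_of lambda_hom_skew_left_brace add mul) /\
  (lambda_anti_hom_weak_left_brace add mul <->
   strong_semilattice_of lambda_anti_hom_skew_left_brace add mul).
Proof.
split; last split; split.
(* In each forward direction, the defining laws are identities and so are inherited by the
   components embedded in [S]. *)
- move=> symS; apply: (dual_strong_semilattice (symmetric_dual symS)).
  move=> T addT mulT h h_inj hD hM [braceT addG mulG]; split=> //.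
  have [addI' mulI' _ _] := braceT.
  case/symmetric_weak_left_brace_satisfies: symS => addI mulI braceS symS.
  have sub := satisfies_sub addI' mulI' addI mulI hD hM h_inj.
  by apply/symmetric_weak_left_brace_satisfies; split=> //; apply: sub.
(* In each converse, the laws are regular identities and lift from the components. *)
- move=> semS; have [addI mulI] := strong_semilattice_inverse semS.
  apply/symmetric_weak_left_brace_satisfies; split=> //;
    apply: (strong_semilattice_satisfies semS) => // T addT mulT _ [symT _ _];
    by case/symmetric_weak_left_brace_satisfies: symT.
- move=> lamS; apply: (dual_strong_semilattice (lambda_homomorphic_dual lamS)).
  move=> T addT mulT h h_inj hD hM braceT; split=> //.
  have [[addI' mulI' _ _] _ _] := braceT.
  case: lamS => -[addI mulI _ _] /lambda_homomorphic_satisfies lamS.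
  apply/lambda_homomorphic_satisfies.
  exact: (satisfies_sub addI' mulI' addI mulI hD hM h_inj).
- move=> semS; split; first exact: strong_semilattice_weak_left_brace semS.
  apply/lambda_homomorphic_satisfies/(strong_semilattice_satisfies semS) => //.
  by move=> T addT mulT _ [_ /lambda_homomorphic_satisfies].
- move=> lamS.
  apply: (dual_strong_semilattice (lambda_anti_homomorphic_dual lamS)).
  move=> T addT mulT h h_inj hD hM braceT; split=> //.
  have [[addI' mulI' _ _] _ _] := braceT.
  case: lamS => -[addI mulI _ _] /lambda_anti_homomorphic_satisfies lamS.
  apply/lambda_anti_homomorphic_satisfies.
  exact: (satisfies_sub addI' mulI' addI mulI hD hM h_inj).
- move=> semS; split; first exact: strong_semilattice_weak_left_brace semS.
  apply/lambda_anti_homomorphic_satisfies.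
  apply: (strong_semilattice_satisfies semS) => //.
  by move=> T addT mulT _ [_ /lambda_anti_homomorphic_satisfies].
Qed.
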